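(* Let $(X,d,a)$ be an upward O-metric space, with $I_a=[a,\infty)$, $d:X\times X\to I_a$ and associated function $\mathbf{o}:I_a\times I_a\to I_a$. Suppose: ($C_1$) there exists $\gamma:[a,\infty)\times[a,\infty)\to\mathbb{R}$ such that whenever $a\le u<r$, one has $\gamma(r,u)>a$ and $\mathbf{o}(u,\gamma(r,u))\le r$; ($C_2$) $\mathbf{o}$ is increasing in both variables. Then the O-metric topology $\mathcal{T}$ on $X$ is first countable and Hausdorff, and $\mathcal{T}=\mathcal{T}_1=\mathcal{T}_2=\mathcal{T}_3$, where $$\mathcal{T}_1=\left\{A\subset X:\ \forall x\in A\ \exists r\in(\operatorname{Im}\mathbf{o})\setminus\{a\},\ B(x,|r-a|)\subset A\right\},$$ $$\mathcal{T}_2=\left\{A\subset X:\ \forall x\in A\ \exists r>0,\ B(x,r)\subset A\right\},$$ $$\mathcal{T}_3=\left\{A\subset X:\ \forall \{x_n\}\subset X,\ \bigl(d(x_n,x)\to a \text{ and } x\in A\bigr)\implies \exists n_0\in\mathbb{N}:\ x_n\in A\ \ \forall n\ge n_0\right\}.$$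
   Context: $\mathbb{R}_+=[0,\infty)$ and $a\in\mathbb{R}_+$. Let $X$ be a non-empty set, $I_a\subset\mathbb{R}_+$ an interval containing $a$, and $\mathbf{o}:I_a\times I_a\to\mathbb{R}_+$ a function. A function $d:X\times X\to I_a$ is an O-metric on $X$, and $(X,d,a)$ is an O-metric space, if for all $x,y,z\in X$: (i) $d(x,y)=a$ if and only if $x=y$; (ii) $d(x,y)=d(y,x)$; (iii) $d(x,z)\le \mathbf{o}(d(x,y),d(y,z))$. It is upward if $I_a\subset[a,\infty)$. $\operatorname{Im}\mathbf{o}=\{\mathbf{o}(u,v):u,v\in I_a\}$. For $x\in X$ and $r>0$, $B(x,r)=\{y\in X:|d(x,y)-a|<r\}$. The O-metric topology $\mathcal{T}$ is the topology $\{A\subset X:\forall x\in A\ \exists r>0,\ B(x,r)\subset A\}$. ''Increasing'' means strictly increasing. *)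

(* Defs.v *)
From HB Require Import structures.
From mathcomp Require Import all_boot all_order all_algebra.
From mathcomp Require Import all_classical all_reals all_analysis.
Import Order.TTheory GRing.Theory Num.Theory.
Import numFieldNormedType.Exports.

Set Implicit Arguments.
Unset Strict Implicit.
Unset Printing Implicit Defensive.

Local Open Scope classical_set_scope.
Local Open Scope ring_scope.

(* A function X * X -> I or I * I -> J between subsets of the reals is encoded
   as a total R-valued function together with the requirement that it maps the
   domain into the codomain; its values outside the domain are never used. *)
Record is_ometric (R : realType) (X : Type) (I : set R) (o : R -> R -> R)
    (d : X -> X -> R) (a : R) : Prop := IsOmetric {
  ometric_interval : is_interval I;
  ometric_nonneg : I `<=` [set u | 0 <= u];
  ometric_base : I a;
  ometric_fun_nonneg : forall u v, I u -> I v -> 0 <= o u v;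
  ometric_dist : forall x y, I (d x y);
  ometric_eq : forall x y, d x y = a <-> x = y;
  ometric_sym : forall x y, d x y = d y x;
  ometric_triangle : forall x y z, d x z <= o (d x y) (d y z)
}.

Definition upward (R : realType) (I : set R) (a : R) : Prop :=
  I `<=` [set u | a <= u].

Definition increasing_both (R : realType) (I : set R) (o : R -> R -> R) : Prop :=
  (forall u u' v, I u -> I u' -> I v -> u < u' -> o u v < o u' v) /\
  (forall u v v', I u -> I v -> I v' -> v < v' -> o u v < o u v').

Definition image_of (R : realType) (I : set R) (o : R -> R -> R) : set R :=
  [set o u v | u in I & v in I].

Definition oball (R : realType) (X : Type) (d : X -> X -> R) (a : R)
    (x : X) (r : R) : set X :=
  [set y | `|d x y - a| < r].

Definition oopen (R : realType) (X : Type) (d : X -> X -> R) (a : R) :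
    set_system X :=
  [set A | forall x, A x -> exists2 r : R, 0 < r & oball d a x r `<=` A].

(* An alias of X carrying the O-metric topology. The sets in [oopen d a] form a
   topology for every d, so the instance needs no O-metric axiom. *)
Definition ometric_space (R : realType) (X : Type) (d : X -> X -> R) (a : R) :
  Type := X.

Section ometric_topology.
Variables (R : realType) (X : Type) (d : X -> X -> R) (a : R).

Lemma oopenT : oopen d a setT.
Proof. by move=> x _; exists 1. Qed.

Lemma oopenI : setI_closed (oopen d a).
Proof.
move=> A B oA oB x [/oA[r r0 rA] /oB[s s0 sB]].
exists (Num.min r s); first by rewrite lt_min r0.
by move=> y; rewrite /oball /= lt_min => /andP[yr ys]; split; [exact: rA|exact: sB].
Qed.

Lemma oopen_bigU (J : Type) (f : J -> set X) :
  (forall i, oopen d a (f i)) -> oopen d a (\bigcup_i f i).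
Proof.
move=> of_ x [i _ /of_[r r0 rf]]; exists r => // y /rf fy.
by exists i.
Qed.

HB.instance Definition _ := gen_eqMixin (ometric_space d a).
HB.instance Definition _ := gen_choiceMixin (ometric_space d a).
HB.instance Definition _ :=
  isOpenTopological.Build (ometric_space d a) oopenT oopenI oopen_bigU.

End ometric_topology.

Definition first_countable (T : topologicalType) : Prop :=
  forall x : T, exists2 B : set_system T, countable B &
    B `<=` nbhs x /\ (forall U, nbhs x U -> exists2 V, B V & V `<=` U).

Definition topology1 (R : realType) (X : Type) (I : set R) (o : R -> R -> R)
    (d : X -> X -> R) (a : R) : set_system X :=
  [set A | forall x, A x ->
     exists2 r : R, (image_of I o `\ a) r & oball d a x `|r - a| `<=` A].

Definition topology2 (R : realType) (X : Type) (d : X -> X -> R) (a : R) :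
    set_system X :=
  [set A | forall x, A x -> exists2 r : R, 0 < r & oball d a x r `<=` A].

Definition topology3 (R : realType) (X : Type) (d : X -> X -> R) (a : R) :
    set_system X :=
  [set A | forall (x_ : nat -> X) (x : X),
     (fun n => d (x_ n) x) @ \oo --> a -> A x ->
     exists n0 : nat, forall n, (n0 <= n)%N -> A (x_ n)].

(* Main.v *)
Require Import Defs.
From mathcomp Require Import all_boot all_order all_algebra.
From mathcomp Require Import all_classical all_reals all_analysis.
Import Order.TTheory GRing.Theory Num.Theory.
Import numFieldNormedType.Exports.
Local Open Scope classical_set_scope.
Local Open Scope ring_scope.

(** Upwardness turns [B(x, r)] into [{y | d x y < a + r}]. If [d x y = u < a + r],
    then [C1] yields [g > a] with [o u g <= a + r], and strict monotonicity of
    [o] makes [d y z < g] imply [d x z < a + r]; so balls are open, whence first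
    countability. Separation is the same computation read backwards: for
    [a < u < d x y] and [o u g <= d x y], no [z] has both [d x z < u] and
    [d z y < g]. *)

Lemma oball_center (R : realType) (X : Type) (I : set R) (o : R -> R -> R)
    (d : X -> X -> R) (a : R) (x : X) (r : R) :
  is_ometric I o d a -> 0 < r -> oball d a x r x.
Proof.
move=> dO r0; rewrite /oball /=.
by have -> : d x x = a; [exact/(ometric_eq dO) | rewrite subrr normr0].
Qed.

Lemma subset_oball (R : realType) (X : Type) (d : X -> X -> R) (a : R) (x : X)
  (r s : R) : r <= s -> oball d a x r `<=` oball d a x s.
Proof. by move=> rs y; rewrite /oball /= => /lt_le_trans; exact. Qed.

Lemma topology2_sub_topology3 (R : realType) (X : Type) (I : set R)
    (o : R -> R -> R) (d : X -> X -> R) (a : R) :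
  is_ometric I o d a -> topology2 d a `<=` topology3 d a.
Proof.
move=> dO A oA x_ x /cvgrPdist_lt cx Ax.
have [r r0 rA] := oA _ Ax.
have [n0 _ n0P] := cx _ r0.
exists n0 => n n0n; apply: rA; rewrite /oball /= (ometric_sym dO) distrC.
exact: n0P.
Qed.

(** By contradiction: if no ball about [x] fits in [A], picking a point outside [A] from each ball
    of radius 1/(n+1) gives a sequence that tends to [x] yet never enters [A]. *)
Lemma topology3_sub_topology2 (R : realType) (X : Type) (I : set R)
    (o : R -> R -> R) (d : X -> X -> R) (a : R) :
  is_ometric I o d a -> topology3 d a `<=` topology2 d a.
Proof.
move=> dO A sA x Ax; apply: contrapT => noball.
have /choice[x_ x_P] (n : nat) :
    exists y, oball d a x n.+1%:R^-1 y /\ ~ A y.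
  apply: contrapT => none; apply: noball; exists n.+1%:R^-1.
    by rewrite invr_gt0.
  by move=> y yB; apply: contrapT => nAy; apply: none; exists y.
have cx : (fun n => d (x_ n) x) @ \oo --> a.
  apply/cvgrPdist_lt => e e0.
  have := near_infty_natSinv_lt (PosNum e0); apply: filterS => n /= ne.
  rewrite distrC (ometric_sym dO); apply: lt_trans ne.
  by have [] := x_P n.
have [n0 /(_ n0 (leqnn _))] := sA _ _ cx Ax.
by have [] := x_P n0.
Qed.

Section upward_ometric.
Context {R : realType} {X : Type} {a : R} {o : R -> R -> R} {d : X -> X -> R}.
Local Notation I := [set u | a <= u].
Hypothesis d_ometric : is_ometric I o d a.
Hypothesis o_codom : forall u v, I u -> I v -> I (o u v).
Hypothesis C1 : exists gamma : R -> R -> R, forall u r, a <= u -> u < r ->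
  a < gamma r u /\ o u (gamma r u) <= r.
Hypothesis C2 : increasing_both I o.

Lemma oballE (x y : X) (r : R) : oball d a x r y = (d x y < a + r) :> Prop.
Proof.
have axy : a <= d x y := ometric_dist d_ometric x y.
by rewrite /oball /= ger0_norm ?subr_ge0// ltrBlDl.
Qed.

Lemma oball_oopen (x : X) (r : R) : oopen d a (oball d a x r).
Proof.
move=> y; rewrite oballE => xyr.
have axy : a <= d x y := ometric_dist d_ometric x y.
have [gamma /(_ _ _ axy xyr)[]] := C1.
set g := gamma _ _ => ag og.
(* By [oballE], this radius turns membership in the ball about [y] into [d y z < g]. *)
exists (g - a); first by rewrite subr_gt0.
move=> z; rewrite !oballE subrKC => yzg.
apply: le_lt_trans (ometric_triangle d_ometric x y z) _.
apply: lt_le_trans og; apply: C2.2 => //; last exact: ltW.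
exact: ometric_dist d_ometric y z.
Qed.

Lemma ometric_first_countable : first_countable (ometric_space d a).
Proof.
move=> x; exists (range (fun n : nat => oball d a x n.+1%:R^-1)).
  exact: card_image_le.
split=> [_ [n _ <-]|U].
  (* A ball is a neighbourhood of its centre because it is itself open; this is where [C1] and [C2]
     enter. *)
  apply: open_nbhs_nbhs; split; first exact: oball_oopen.
  by apply: oball_center d_ometric _; rewrite invr_gt0.
rewrite nbhsE => -[V [oV Vx] VU].
have [r r0 rV] : exists2 r : R, 0 < r & oball d a x r `<=` V by exact: oV.
have [N _ /(_ N (leqnn N)) /= Nr] := near_infty_natSinv_lt (PosNum r0).
exists (oball d a x N.+1%:R^-1); first by exists N.
apply: subset_trans VU; apply: subset_trans rV.
exact/subset_oball/ltW.
Qed.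

Lemma ometric_hausdorff : hausdorff_space (ometric_space d a).
Proof.
rewrite open_hausdorff => x y /eqP xy.
have axy : a < d x y.
  rewrite lt_neqAle (ometric_dist d_ometric x y : a <= _) andbT.
  by apply/eqP => /esym /(ometric_eq d_ometric).
(* The midpoint serves as a value strictly between: [a < u] makes the radius [u - a] positive, and
   [u < d x y] lets [C1] apply. *)
have [au uxy] := midf_lt axy.
set u := (a + d x y) / 2 in au uxy.
have [gamma /(_ _ _ (ltW au) uxy)[]] := C1.
set g := gamma _ _ => ag og.
exists (oball d a x (u - a), oball d a y (g - a)) => /=.
  by split; apply/mem_set; apply: oball_center d_ometric _; rewrite subr_gt0.
split; [exact: oball_oopen|exact: oball_oopen|].
apply/eqP; rewrite -subset0 => z [].
rewrite !oballE !subrKC => xzu; rewrite (ometric_sym d_ometric) => zyg.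
have axz : a <= d x z := ometric_dist d_ometric x z.
have azy : a <= d z y := ometric_dist d_ometric z y.
(* A common point [z] would give the chain [d x y <= o (d x z) (d z y) < o u (d z y) < o u g <= d x
   y]. *)
have : d x y < d x y; last by rewrite ltxx.
apply: le_lt_trans (ometric_triangle d_ometric x z y) _.
apply: lt_le_trans og; apply: (@lt_trans _ _ (o u (d z y))).
  by apply: C2.1 => //; exact: ltW.
by apply: C2.2 => //; exact: ltW.
Qed.

(** Radii [|r - a|] with [r] in the image of [o] and [r <> a] are positive; conversely they can be
    made arbitrarily small, since [C1] at [u = a] yields values of [o] just above [a]. *)
Lemma topology1_eq_topology2 : topology1 I o d a = topology2 d a.
Proof.
apply/seteqP; split=> A oA x Ax; have [r r0 rA] := oA _ Ax.
  by exists `|r - a| => //; rewrite normr_gt0 subr_eq0; apply/eqP; case: r0.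
have aar : a < a + r by rewrite ltrDl.
have [gamma /(_ _ _ (lexx a) aar)[]] := C1.
set g := gamma _ _ => ag og.
have Ia : I a by exact: lexx.
have Ig : I g by exact: ltW.
(* Strictness keeps this value off [a]: [a <= o a a < o a g]. *)
have aog : a < o a g by apply: le_lt_trans (o_codom _ _ Ia Ia) _; exact: C2.2.
exists (o a g).
  by split; [exists a => //; exists g | move=> oa; rewrite oa ltxx in aog].
apply: subset_trans rA; apply: subset_oball.
by rewrite gtr0_norm ?subr_gt0// lerBlDl.
Qed.

End upward_ometric.

Theorem proposition2p32 (R : realType) (X : Type) (X_neq0 : [set: X] !=set0)
    (a : R) (I : set R) (o : R -> R -> R) (d : X -> X -> R)
    (I_def : I = [set u | a <= u])
    (d_ometric : is_ometric I o d a)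
    (d_upward : upward I a)
    (o_codom : forall u v, I u -> I v -> I (o u v))
    (C1 : exists gamma : R -> R -> R, forall u r, a <= u -> u < r ->
            a < gamma r u /\ o u (gamma r u) <= r)
    (C2 : increasing_both I o) :
  first_countable (ometric_space d a) /\
  hausdorff_space (ometric_space d a) /\
  (@open (ometric_space d a) = topology1 I o d a /\
   topology1 I o d a = topology2 d a /\
   topology2 d a = topology3 d a).
Proof.
subst I.
have T12 := topology1_eq_topology2 o_codom C1 C2.
split; first exact: ometric_first_countable d_ometric C1 C2.
split; first exact: ometric_hausdorff d_ometric C1 C2.
(* The open sets of [ometric_space d a] are [oopen d a], which is [topology2 d a] by conversion. *)
split; [by rewrite T12 | split=> //].
apply/seteqP; split; first exact: topology2_sub_topology3 d_ometric.
exact: topology3_sub_topology2 d_ometric.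
Qed.
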